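(* Let $n\ge1$, $s\in\{1,\dots,n\}$ and let $C\in\mathbb{R}^{n\times n}$ be symmetric positive definite. For every $t$ with $0<t\le\lambda_{\min}(C)$, $\hat z(0)\ge\hat z(t)$.
   Context: $\lambda_{\min}(C)$ is the smallest eigenvalue of $C$. For $0\le t\le\lambda_{\min}(C)$ let $A(t)\in\mathbb{R}^{n\times n}$ be a Cholesky factor of $C-tI$ (so $C-tI=A(t)^\top A(t)$), with $i$-th column $a_i(t)$, and for $x\in[0,1]^n$ let $M_t(x)=\sum_i x_i a_i(t)a_i(t)^\top$. For a positive semidefinite $X$ with eigenvalues $\lambda_1(X)\ge\dots\ge\lambda_n(X)$ and $t\ge0$, $\Phi_s(X;t)=\sum_{i=1}^s\log(\lambda_i(X)+t)$ (natural log); $\widehat{\Phi}_s(\cdot\,;t)$ is its concave envelope on the cone of $n\times n$ positive semidefinite matrices (pointwise infimum of all concave functions there that are $\ge\Phi_s(\cdot\,;t)$). $\hat z(t)=\max\{\widehat{\Phi}_s(M_t(x);t) : x\in[0,1]^n,\ \sum_i x_i=s\}$; in particular $\hat z(0)$ is the factorization bound. *)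

(* Defs.v *)
From HB Require Import structures.
From mathcomp Require Import all_boot all_order all_algebra.
From mathcomp Require Import all_classical all_reals.
From mathcomp Require Import ereal exp.

Set Implicit Arguments.
Unset Strict Implicit.
Unset Printing Implicit Defensive.

Import Order.TTheory GRing.Theory Num.Theory.
Local Open Scope classical_set_scope.
Local Open Scope ring_scope.

Section Defs.
Variable R : realType.
Variable n : nat.

Definition psd (X : 'M[R]_n) : Prop :=
  X^T = X /\ forall v : 'cV[R]_n, 0 <= (v^T *m X *m v) 0 0.

Definition posdef (X : 'M[R]_n) : Prop :=
  X^T = X /\ forall v : 'cV[R]_n, v != 0 -> 0 < (v^T *m X *m v) 0 0.

Definition sorted_eigs_spec (X : 'M[R]_n) (e : seq R) : Prop :=
  [/\ size e = n, sorted >=%R e & char_poly X = \prod_(x <- e) ('X - x%:P)].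

(* lambda_1(X) >= ... >= lambda_n(X); well defined for symmetric X *)
Definition eigs (X : 'M[R]_n) : seq R := xget (nseq n 0) (sorted_eigs_spec X).

Definition eig (X : 'M[R]_n) (i : nat) : R := nth 0 (eigs X) i.

Definition lambda_min (X : 'M[R]_n) : R := eig X n.-1.

Definition cholesky_factor (X A : 'M[R]_n) : Prop :=
  [/\ X = A^T *m A,
      (forall i j : 'I_n, (j < i)%N -> A i j = 0) &
      (forall i : 'I_n, 0 <= A i i)].

Definition Mx (A : 'M[R]_n) (x : 'I_n -> R) : 'M[R]_n :=
  \sum_(i < n) x i *: (col i A *m (col i A)^T).

Definition logE (y : R) : \bar R := if 0 < y then (ln y)%:E else -oo%E.

Definition Phi (s : nat) (X : 'M[R]_n) (t : R) : \bar R :=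
  (\sum_(i < s) logE (eig X i + t))%E.

Definition concave_on_psd (g : 'M[R]_n -> R) : Prop :=
  forall (X Y : 'M[R]_n) (l : R), psd X -> psd Y -> 0 <= l <= 1 ->
    l * g X + (1 - l) * g Y <= g (l *: X + (1 - l) *: Y).

Definition Phi_hat (s : nat) (X : 'M[R]_n) (t : R) : \bar R :=
  ereal_inf [set (g X)%:E | g in
    [set g : 'M[R]_n -> R | concave_on_psd g /\
       (forall Y, psd Y -> (Phi s Y t <= (g Y)%:E)%E)]].

Definition feasible (s : nat) : set ('I_n -> R) :=
  [set x | (forall i, 0 <= x i <= 1) /\ \sum_(i < n) x i = s%:R].

(* hat z(t), with A t a Cholesky factor of C - t I *)
Definition z_hat (s : nat) (A : R -> 'M[R]_n) (t : R) : \bar R :=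
  ereal_sup [set Phi_hat s (Mx (A t) x) t | x in feasible s].

End Defs.

(* Main.v *)
Require Import Defs.
From HB Require Import structures.
From mathcomp Require Import all_boot all_order all_algebra.
From mathcomp Require Import all_classical all_reals.
From mathcomp Require Import ereal exp.
From mathcomp Require Import perm complex ring lra.

Import Order.TTheory GRing.Theory Num.Theory.
Local Open Scope classical_set_scope.
Local Open Scope ring_scope.

(** Fix a feasible [x], put [D = diag x] and [S = sqrt D].  The matrices [M_t(x)]
    and [M_0(x)] have the spectra of [B = S (C - t I) S] and [N = B + t D].  Let
    [u_i = eig B i + t] for [i < s] and [u_i = eig B i] otherwise, and let
    [m = (u_0, .., u_(k-1), c, .., c, 0, .., 0)] with [s] nonzero entries, where
    [c] is the tail sum of [u] from [k] divided by [s - k] and [k] is the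
    Nikolov index, for which [m] is nonincreasing and majorizes [u].  The
    common bound separating the two envelopes is the sum of [ln m_i], [i < s]:
    - concavity of [ln] and von Neumann's trace inequality give an affine
      function above [Phi_s(.; t)] taking this value at [B];
    - as [0 <= D <= I] and [tr D = s], Ky Fan's principle shows that the
      eigenvalues of [N] are majorized by [u], hence by [m], so [N] is a convex
      combination of matrices with spectrum [m], and a concave majorant of
      [Phi_s(.; 0)] is at least this value at [N]. *)

(** * Characteristic polynomials and the real spectral theorem *)

(** Two multiples of [M] by block-triangular matrices clear its lower-left block and yield one
    characteristic polynomial each, the second with a factor ['X^n] on both sides that cancels. *)
Lemma char_poly_mulC (F : idomainType) (n : nat) (A B : 'M[F]_n) :
  char_poly (A *m B) = char_poly (B *m A).
Proof.
pose a := map_mx (@polyC F) A; pose b := map_mx (@polyC F) B.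
pose M := block_mx 'X%:M a b (1%:M : 'M_n).
have detl : \det M = char_poly (A *m B).
  have := det_mulmx M (block_mx (1%:M : 'M_n) 0 (- b) (1%:M : 'M_n)).
  rewrite det_lblock !det1 !mulr1 => <-.
  rewrite mulmx_block !mulmx1 !mulmx0 !mul1mx !add0r.
  by rewrite mulmxN subrr det_ublock det1 mulr1 /char_poly /char_poly_mx map_mxM.
have detr : 'X^n * \det M = 'X^n * char_poly (B *m A).
  have := det_mulmx (block_mx (1%:M : 'M_n) 0 (- b) 'X%:M) M.
  rewrite det_lblock det1 mul1r det_scalar => <-.
  rewrite mulmx_block !mul1mx !mul0mx !addr0 mulmx1.
  rewrite mulNmx scalar_mxC addNr det_ublock det_scalar.
  by rewrite mulNmx addrC /char_poly /char_poly_mx map_mxM.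
by rewrite -detl; apply: (mulfI _ detr); rewrite monic_neq0 ?monicXn.
Qed.

Lemma char_poly_diag (F : comNzRingType) (n : nat) (d : 'rV[F]_n) :
  char_poly (diag_mx d) = \prod_(i < n) ('X - (d 0 i)%:P).
Proof.
rewrite char_poly_trig ?diag_mx_is_trig //.
by apply: eq_bigr => i _; rewrite mxE eqxx.
Qed.

(** Over the complex numbers the matrix is Hermitian, hence unitarily diagonalizable with real
    diagonal; the factorization descends because the embedding is injective on polynomials. *)
Lemma char_poly_real_sym (R : realType) (n : nat) (A : 'M[R]_n) :
  A^T = A -> exists d : 'rV[R]_n, char_poly A = \prod_(i < n) ('X - (d 0 i)%:P).
Proof.
move=> symA; pose f := real_complex R.
have symfA : map_mx f A \is hermsymmx.
  apply: realsym_hermsym.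
    apply/is_hermitianmxP; rewrite expr0 scale1r map_mx_id //.
    by apply/matrixP => i j; rewrite !mxE -[in RHS]symA mxE.
  by apply/mxOverP => i j; rewrite mxE; apply/complex_realP; exists (A i j).
have sp := hermitian_spectral_diag_real symfA.
have /hermitian_normalmx/orthomx_spectralP eqA := symfA.
have [d eqd] : exists d, spectral_diag (map_mx f A) = map_mx f d.
  exists (map_mx (@complex.Re R) (spectral_diag (map_mx f A))).
  by apply/rowP => i; rewrite !mxE /f RRe_real //; exact: (mxOverP sp).
exists d; apply: (map_poly_inj f); rewrite map_char_poly eqA.
rewrite -mulmxA char_poly_mulC -mulmxA mulmxV ?spectral_unit // mulmx1.
rewrite char_poly_diag rmorph_prod; apply: eq_bigr => i _.
by rewrite rmorphB /= map_polyX map_polyC /= eqd mxE.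
Qed.

Lemma dot_rV_gt0 (R : realDomainType) (n : nat) (v : 'rV[R]_n) :
  v != 0 -> 0 < (v *m v^T) 0 0.
Proof.
move=> v_neq0; rewrite mxE; have [j vj] : exists j, v 0 j != 0.
  apply/existsP; apply: contra_neqT v_neq0 => /existsPn v0.
  by apply/rowP => j; rewrite [RHS]mxE; apply/eqP; move: (v0 j); rewrite negbK.
rewrite (bigD1 j) //= [_^T _ _]mxE ltr_pwDl //.
  by rewrite lt_def -expr2 sqr_ge0 sqrf_eq0 vj.
by apply: sumr_ge0 => i _; rewrite [_^T _ _]mxE -expr2 sqr_ge0.
Qed.

(** For [u != v], reflect along [w = u - v]: unit lengths make [u *m w^T] half of [w *m w^T], so [u]
    goes to [u - w]. *)
Lemma householder (R : realFieldType) (n : nat) (u v : 'rV[R]_n) :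
  u *m u^T = 1%:M -> v *m v^T = 1%:M ->
  exists H : 'M[R]_n, [/\ H^T = H, H *m H = 1%:M & u *m H = v].
Proof.
move=> uu vv; case: (eqVneq u v) => [<-|neq_uv].
  by exists 1%:M; rewrite trmx1 !mulmx1.
have [w wE] : exists w, w = u - v by exists (u - v).
have w_neq0 : w != 0 by rewrite wE subr_eq0.
pose k := (w *m w^T) 0 0.
have uv : v *m u^T = u *m v^T.
  by rewrite -[LHS]trmxK trmx_mul trmxK; apply/matrixP => i j; rewrite !ord1 mxE.
have kE : w *m w^T = k%:M by rewrite [LHS]mx11_scalar.
have k_gt0 : 0 < k by exact: dot_rV_gt0.
have uw : (u *m w^T) = (k / 2)%:M.
  have : w *m w^T = u *m w^T + u *m w^T.
    have -> : w^T = u^T - v^T by rewrite wE linearB.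
    by rewrite {1}wE mulmxBl !mulmxBr uu vv uv opprB.
  rewrite kE [u *m _]mx11_scalar => /matrixP/(_ 0 0); rewrite !mxE /= !mulr1n => ->.
  by congr (_%:M); field.
exists (1%:M - (2 / k) *: (w^T *m w)); split.
- by rewrite linearB linearZ /= trmx1 trmx_mul trmxK.
- rewrite mulmxBl mul1mx mulmxBr mulmx1 -scalemxAl -scalemxAr scalerA.
  rewrite mulmxA -[w^T *m w *m _]mulmxA kE mul_mx_scalar -scalemxAl scalerA.
  have -> : 2 / k * (2 / k) * k = 2 / k + 2 / k by field; rewrite gt_eqF.
  by rewrite scalerDl opprB addrK subrK.
- rewrite mulmxBr mulmx1 -scalemxAr mulmxA uw mul_scalar_mx scalerA.
  have -> : 2 / k * (k / 2) = 1 by field; rewrite gt_eqF.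
  by rewrite scale1r wE opprB addrC subrK.
Qed.

(** Deflation: a reflection carries the first basis vector to a unit eigenvector. Conjugation by it
    gives, by symmetry, a block-diagonal matrix whose lower block falls to the induction
    hypothesis. *)
Lemma spectral_real_sym (R : realType) (n : nat) (A : 'M[R]_n) : A^T = A ->
  exists (U : 'M[R]_n) (d : 'rV[R]_n),
    U *m U^T = 1%:M /\ A = U *m diag_mx d *m U^T.
Proof.
elim: n A => [|n IHn] A symA.
  by exists 1%:M, 0; split; apply/matrixP => -[].
have [d0 pA] := char_poly_real_sym _ _ _ symA.
have [v vA v_neq0] : exists2 v : 'rV_n.+1, v *m A = d0 0 0 *: v & v != 0.
  apply/eigenvalueP; rewrite eigenvalue_root_char pA big_ord_recl.
  by rewrite rootM root_XsubC eqxx.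
pose a := d0 0 0; pose k := (v *m v^T) 0 0.
have k_gt0 : 0 < k by exact: dot_rV_gt0.
pose e0 : 'rV[R]_n.+1 := delta_mx 0 0; pose w := (Num.sqrt k)^-1 *: v.
have ww : w *m w^T = 1%:M.
  rewrite /w linearZ /= -scalemxAl -scalemxAr scalerA [_ *m _]mx11_scalar -/k.
  rewrite -invfM -expr2 sqr_sqrtr ?ltW // -scalemx1 scalerA mulVf ?gt_eqF //.
  by rewrite scale1r.
have ee : e0 *m e0^T = 1%:M.
  by rewrite /e0 trmx_delta mul_delta_mx [LHS]mx11_scalar mxE eqxx.
have [H [symH HH eH]] := householder _ _ _ _ ee ww.
have [B BHAH] : exists B : 'M[R]_(1 + n), B = H *m A *m H by eexists.
have symB : B^T = B by rewrite BHAH !trmx_mul symH symA mulmxA.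
have eB : e0 *m B = a *: e0.
  rewrite BHAH !mulmxA eH /w -scalemxAl vA scalerA mulrC -scalerA -/w.
  by rewrite -scalemxAl -eH -mulmxA HH mulmx1.
have B0 j : B 0 j = a *+ (j == 0).
  have /matrixP/(_ 0 j) := eB; rewrite /e0 -rowE !mxE eqxx /= => ->.
  by case: eqP; rewrite ?mulr1 ?mulr0.
have [|U [d [UU drE]]] := IHn (drsubmx B).
  by rewrite trmx_drsub symB.
pose V : 'M[R]_(1 + n) := block_mx 1%:M 0 0 U.
have VV : V *m V^T = 1%:M.
  rewrite /V tr_block_mx !trmx0 trmx1 mulmx_block UU.
  by rewrite !(mulmx1, mul1mx, mulmx0, mul0mx, addr0, add0r) -scalar_mx_block.
have BE : B = V *m diag_mx (row_mx (a%:M : 'M_1) d) *m V^T.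
  rewrite /V tr_block_mx !trmx0 trmx1 diag_mx_row !mulmx_block.
  rewrite !(mulmx1, mul1mx, mulmx0, mul0mx, addr0, add0r) -drE.
  rewrite -[LHS]submxK; congr block_mx.
  - apply/matrixP => i j; rewrite !ord1 !mxE lshift0 B0 eqxx /= ?mulr1n.
    by rewrite ?eqxx ?mulr1n.
  - by apply/matrixP => i j; rewrite !ord1 !mxE lshift0 B0.
  - apply/matrixP => i j; rewrite !ord1 !mxE lshift0 -[B]symB mxE B0.
    by [].
exists (H *m V), (row_mx (a%:M : 'M_1) d); split.
  rewrite trmx_mul mulmxA -[H *m V *m _]mulmxA symH.
  by rewrite VV mulmx1.
rewrite trmx_mul symH !mulmxA -[_ *m V *m _]mulmxA -[H *m _ *m _]mulmxA -BE BHAH.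
by rewrite !mulmxA HH mul1mx -mulmxA HH mulmx1.
Qed.

(** * Sorted eigenvalues of symmetric matrices *)

Section Eigenvalues.
Context {R : realType} {n : nat}.
Implicit Types (A U X Y : 'M[R]_n) (d : 'rV[R]_n) (e : nat -> R).

Lemma conj_diagE U d i j :
  (U *m diag_mx d *m U^T) i j = \sum_(k < n) d 0 k * (U i k * U j k).
Proof.
rewrite mxE; apply: eq_bigr => k _.
by rewrite mul_mx_diag !mxE mulrAC mulrC mulrA.
Qed.

Lemma char_poly_conj_diag U d : U *m U^T = 1%:M ->
  char_poly (U *m diag_mx d *m U^T) = \prod_(i < n) ('X - (d 0 i)%:P).
Proof.
move=> /mulmx1C UU.
by rewrite -mulmxA char_poly_mulC -mulmxA UU mulmx1 char_poly_diag.
Qed.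

Lemma eigs_unique X (e : seq R) : sorted_eigs_spec X e -> eigs X = e.
Proof.
move=> Xe; have [_ se pe] := Xe.
have [_ se' pe'] : sorted_eigs_spec X (eigs X) by apply: xgetPex; exists e.
apply: (sorted_eq _ _ se' se).
- exact: ge_trans.
- exact: ge_anti.
- by apply: prod_XsubC_eq; rewrite -pe' -pe.
Qed.

Lemma eq_eigs X Y : char_poly X = char_poly Y -> eigs X = eigs Y.
Proof.
move=> eqp; rewrite /eigs; congr xget; apply/funext => e.
by rewrite /sorted_eigs_spec eqp.
Qed.

(** Since [eig] sorts, the order [p] of the diagonal is irrelevant; hence every permuted vector
    [m \o p] of the majorization argument gives a matrix with spectrum [m]. *)
Lemma eig_conj_diag_perm U e (p : 'S_n) : U *m U^T = 1%:M ->
  (forall i j, (i <= j)%N -> e j <= e i) ->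
  forall i, (i < n)%N ->
    eig (U *m diag_mx (\row_j e (p j)) *m U^T) i = e i.
Proof.
move=> UU he i lt_in; rewrite /eig.
rewrite (@eigs_unique _ [seq e j | j <- iota 0 n]).
  by rewrite (nth_map 0) ?size_iota // nth_iota.
split; first by rewrite size_map size_iota.
- apply: (homo_sorted (e := leq)); last exact: iota_sorted.
  by move=> a b /he.
- rewrite char_poly_conj_diag // big_map -[n in iota 0 n]subn0 big_mkord.
  rewrite [RHS](reindex_inj (@perm_inj _ p)) /=.
  by apply: eq_bigr => j _; rewrite mxE.
Qed.

Lemma eigs_sym_spec A : A^T = A -> sorted_eigs_spec A (eigs A).
Proof.
move=> symA; have [d pA] := char_poly_real_sym _ _ _ symA.
pose s := sort >=%R [seq d 0 i | i <- enum 'I_n].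
have sP : sorted_eigs_spec A s.
  split; first by rewrite size_sort size_map size_enum_ord.
    by apply: sort_sorted => a b; exact: le_total.
  by rewrite pA (perm_big _ (permEl (perm_sort _ _))) /= big_map big_enum.
by rewrite (eigs_unique _ _ sP).
Qed.

(** The diagonal of any orthogonal diagonalization and the sorted list are roots of the same
    polynomial, so permuting the columns turns one into the other. *)
Lemma spectral_eig A : A^T = A ->
  exists U, U *m U^T = 1%:M /\ A = U *m diag_mx (\row_i eig A i) *m U^T.
Proof.
move=> symA; have [szA _ charA] := eigs_sym_spec _ symA.
have [V [d [VV AE]]] := spectral_real_sym _ _ _ symA.
pose t := [tuple d 0 i | i < n].
have szt : size (eigs A) == n by apply/eqP.
have /tuple_permP[p eqp] : perm_eq (Tuple szt) t.
  apply: prod_XsubC_eq; rewrite /= -charA {1}AE char_poly_conj_diag //.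
  by rewrite big_map -[index_enum _]enumT big_enum.
have eigE i : eig A (i : 'I_n) = d 0 (p i).
  by rewrite /eig; rewrite /= in eqp; rewrite eqp nth_mktuple tnth_mktuple.
exists (col_perm p V); split.
  apply/matrixP => i j; rewrite -VV !mxE [RHS](reindex_inj (@perm_inj _ p)) /=.
  by apply: eq_bigr => k _; rewrite !mxE.
apply/matrixP => i j; rewrite {1}AE !conj_diagE.
rewrite [LHS](reindex_inj (@perm_inj _ p)) /=.
by apply: eq_bigr => k _; rewrite !mxE eigE.
Qed.

Lemma sum_eig A : A^T = A -> \sum_(i < n) eig A i = \tr A.
Proof.
move=> /spectral_eig[U [/mulmx1C UU AE]].
rewrite [in RHS]AE -mulmxA mxtrace_mulC -mulmxA UU mulmx1 mxtrace_diag.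
by apply: eq_bigr => i _; rewrite mxE.
Qed.

Lemma psd_conj_diag U d : (forall i, 0 <= d 0 i) ->
  psd (U *m diag_mx d *m U^T).
Proof.
move=> d_ge0; split; first by rewrite !trmx_mul trmxK tr_diag_mx mulmxA.
move=> v; rewrite !mulmxA -[_ *m U^T *m v]mulmxA.
have -> : U^T *m v = (v^T *m U)^T by rewrite trmx_mul trmxK.
rewrite mxE; apply: sumr_ge0 => k _.
by rewrite mul_mx_diag !mxE mulrAC mulr_ge0 // -expr2 sqr_ge0.
Qed.

(** The default of [nth] extends monotonicity to all naturals for psd matrices and supplies the end
    value 0 for summation by parts. *)
Lemma eig_default A i : A^T = A -> (n <= i)%N -> eig A i = 0.
Proof.
by move=> /eigs_sym_spec[szA _ _] le_ni; rewrite /eig nth_default ?szA.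
Qed.

Lemma psd_eig_ge0 A i : psd A -> 0 <= eig A i.
Proof.
move=> [symA A_ge0]; case: (ltnP i n) => [lt_in|]; last first.
  by move=> /eig_default ->.
have [U [/mulmx1C UU AE]] := spectral_eig _ symA.
have := A_ge0 (col (Ordinal lt_in) U).
have -> : (col (Ordinal lt_in) U)^T *m A *m col (Ordinal lt_in) U =
  (delta_mx (Ordinal lt_in) 0)^T *m (U^T *m A *m U) *m delta_mx (Ordinal lt_in) 0.
  by rewrite colE trmx_mul !mulmxA.
have -> : U^T *m A *m U = diag_mx (\row_i eig A i).
  by rewrite {1}AE !mulmxA UU mul1mx -mulmxA UU mulmx1.
by rewrite -mulmxA -colE trmx_delta -rowE !mxE eqxx.
Qed.

Lemma psd_eig_nonincr A i j : psd A -> (i <= j)%N -> eig A j <= eig A i.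
Proof.
move=> psdA le_ij; have [symA _] := psdA.
case: (ltnP j n) => [lt_jn|le_nj].
  have [szA sA _] := eigs_sym_spec _ symA.
  apply: (sorted_leq_nth (leT := >=%R)) => //; first exact: ge_trans.
  - by move=> x; exact: lexx.
  - by rewrite inE szA (leq_ltn_trans le_ij).
  - by rewrite inE szA.
by rewrite (eig_default _ _ symA le_nj) psd_eig_ge0.
Qed.
End Eigenvalues.

(** * Rearrangement inequalities, majorization and Nikolov weights *)

Section Majorization.
Context {R : realFieldType} {n : nat}.

(** Both weightings have the same total, so [b] may be shifted by the threshold [b k.-1]; then
    [b i - b k.-1] and the difference of the weights at [i] never have opposite signs. *)
Lemma bathtub (b : nat -> R) (q : 'I_n -> R) (k : nat) :
  (forall i j, (i <= j)%N -> b j <= b i) ->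
  (forall i, 0 <= q i <= 1) ->
  \sum_(i < n) q i = \sum_(i < n | (i < k)%N) 1 ->
  \sum_(i < n) b i * q i <= \sum_(i < n | (i < k)%N) b i.
Proof.
move=> hb hq sq; rewrite -subr_ge0.
have hk (f : 'I_n -> R) :
    \sum_(i < n | (i < k)%N) f i = \sum_(i < n) f i * (i < k)%N%:R.
  rewrite big_mkcond; apply: eq_bigr => i _.
  by case: ifP => _; rewrite ?mulr1 ?mulr0.
have s0 : \sum_(i < n) ((i < k)%N%:R - q i) = 0.
  by rewrite sumrB sq hk -sumrB big1 // => i _; rewrite mul1r subrr.
have -> : \sum_(i < n | (i < k)%N) b i - \sum_(i < n) b i * q i =
    \sum_(i < n) (b i - b k.-1) * ((i < k)%N%:R - q i).
  transitivity (\sum_(i < n) (b i * (i < k)%N%:R - b i * q i) -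
      b k.-1 * \sum_(i < n) ((i < k)%N%:R - q i)).
    by rewrite s0 mulr0 subr0 hk sumrB.
  by rewrite mulr_sumr -sumrB; apply: eq_bigr => i _; ring.
apply: sumr_ge0 => i _; have /andP[q0 q1] := hq i.
case: ltnP => ik; rewrite /= ?sub0r.
  rewrite mulr_ge0 ?subr_ge0 // hb //.
  by rewrite -ltnS (ltn_predK ik).
rewrite mulr_le0 ?subr_le0 ?oppr_le0 // hb //.
by rewrite (leq_trans _ ik) ?leq_pred.
Qed.

(** Summation by parts: [b n = 0] makes [b i] a telescoping sum of nonnegative decrements, each of
    which multiplies a prefix sum of [a]. *)
Lemma abel_sum_ge0 (b : nat -> R) (a : 'I_n -> R) :
  (forall i j, (i <= j)%N -> b j <= b i) -> b n = 0 ->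
  (forall k, 0 <= \sum_(i < n | (i < k)%N) a i) ->
  0 <= \sum_(i < n) b i * a i.
Proof.
move=> hb bn ha.
have bE (i : 'I_n) : b i = \sum_(k < n | (i < k.+1)%N) (b k - b k.+1).
  transitivity (\sum_(i <= k < n) (b k - b k.+1)); last first.
    by rewrite (big_nat_widenl _ 0) // big_mkord.
  rewrite (eq_bigr (fun k => - (b k.+1 - b k))); last by move=> k _; rewrite opprB.
  by rewrite sumrN telescope_sumr ?bn ?sub0r ?opprK // ltnW.
under eq_bigr => i _ do rewrite bE mulr_suml.
rewrite (exchange_big_dep xpredT) //=; apply: sumr_ge0 => k _.
by rewrite -mulr_sumr mulr_ge0 ?subr_ge0 ?hb.
Qed.

End Majorization.

Section HLP.
Context {R : realFieldType} {n : nat}.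

(* Hardy-Littlewood-Polya by T-transforms: each step moves [m] closer to [v] along
   two coordinates, so that one more coordinate agrees. *)
Lemma majorization_convex (P : ('I_n -> R) -> Prop) (v m : 'I_n -> R) :
  (forall x y l, 0 <= l <= 1 -> P x -> P y ->
    P (fun i => l * x i + (1 - l) * y i)) ->
  (forall p : 'S_n, P (m \o p)) ->
  (forall i j : 'I_n, (i <= j)%N -> v j <= v i) ->
  (forall k, \sum_(i < n | (i < k)%N) v i <= \sum_(i < n | (i < k)%N) m i) ->
  \sum_(i < n) v i = \sum_(i < n) m i ->
  P v.
Proof.
move=> convP; have [c] := ubnP #|[pred i | v i != m i]|.
elim: c m => // c IHc m card_vm permP v_noninc prefix total.
case: (pickP (fun i => m i < v i)) => [k0 k0P|no_k]; last first.
  have eq_vm : v = m \o (1%g : 'S_n).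
    apply/funext => i; rewrite /= perm1; apply/eqP.
    have ge0 j : 0 <= m j - v j by rewrite subr_ge0 leNgt no_k.
    have := @psumr_eq0P _ _ xpredT (fun j => m j - v j) (fun j _ => ge0 j).
    by rewrite sumrB total subrr => /(_ erefl i isT)/subr0_eq ->.
  by rewrite eq_vm.
case: (@arg_minnP _ k0 (fun i => m i < v i) (@nat_of_ord n) k0P) => k k_gt k_min.
(* Otherwise [m <= v] before [k] and [m k < v k], against the prefix inequality at [k.+1]. *)
have [j /andP[lt_jk j_lt]] : exists j : 'I_n, (j < k)%N && (v j < m j).
  apply/existsP; apply: contraLR (prefix k.+1) => /existsPn no_j.
  rewrite -ltNge (bigD1 k) //= [ltRHS](bigD1 k) //= ltr_leD //.
  apply: ler_sum => i /andP[]; rewrite ltnS leq_eqVlt -val_eqE /=.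
  case: eqP => //= _ lt_ik _; move: (no_j i); rewrite lt_ik /=.
  by rewrite -leNgt.
have neq_jk : j != k by rewrite -val_eqE /= ltn_eqF.
(* The largest transfer from [j] to [k] that overshoots [v] at neither; the coordinate attaining the
   minimum then agrees with [v]. *)
pose d := Num.min (m j - v j) (v k - m k).
have d_gt0 : 0 < d by rewrite lt_min !subr_gt0 j_lt.
have d_lej : d <= m j - v j by rewrite ge_min lexx.
have d_lek : d <= v k - m k by rewrite ge_min lexx orbT.
have v_jk : v k <= v j by rewrite v_noninc // ltnW.
pose m' i := m i - d * (i == j)%:R + d * (i == k)%:R.
have sum_delta (Q : pred 'I_n) (i0 : 'I_n) :
    \sum_(i < n | Q i) (i == i0)%:R = (Q i0)%:R :> R.
  rewrite big_mkcond (bigD1 i0) //= big1 ?addr0; first by rewrite eqxx; case: (Q i0).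
  by move=> i /negbTE ->; case: ifP.
have sum_m' (Q : pred 'I_n) : \sum_(i < n | Q i) m' i =
    \sum_(i < n | Q i) m i - d * (Q j)%:R + d * (Q k)%:R.
  by rewrite big_split sumrB /= -!mulr_sumr !sum_delta.
apply: (IHc m') => //.
- rewrite -ltnS (leq_trans _ card_vm) // ltnS; apply/proper_card/properP.
  have sub : [pred i | v i != m' i] \subset [pred i | v i != m i].
    apply/fintype.subsetP => i; rewrite !inE /m'.
    case: (eqVneq i j) => [-> _|_]; first by rewrite lt_eqF.
    case: (eqVneq i k) => [-> _|_]; first by rewrite gt_eqF.
    by rewrite !mulr0 subr0 addr0.
  split=> //; have [de|de] := leP (m j - v j) (v k - m k).
    exists j; rewrite !inE; first by rewrite lt_eqF.
    by rewrite negbK /m' eqxx (negbTE neq_jk) /d min_l //= mulr1 mulr0; apply/eqP; ring.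
  exists k; rewrite !inE; first by rewrite gt_eqF.
  rewrite negbK /m' eqxx [k == j]eq_sym (negbTE neq_jk) /d min_r ?ltW //=.
  by rewrite mulr1 mulr0; apply/eqP; ring.
- move=> p.
  have mjk : 0 < m j - m k by lra.
  (* With this [l], the transfer is a convex combination of [m] and [m] with [j] and [k] exchanged,
     so [P] passes to all permutations of [m']. *)
  pose l := 1 - d / (m j - m k).
  have -> : m' \o p = fun i => l * (m \o p) i + (1 - l) * (m \o (p * tperm j k)%g) i.
    apply/funext => i; rewrite /= permM /m' /l.
    case: tpermP => [->|->|/eqP/negbTE -> /eqP/negbTE ->].
    + by rewrite eqxx (negbTE neq_jk) /=; field; rewrite gt_eqF.
    + by rewrite eqxx eq_sym (negbTE neq_jk) /=; field; rewrite gt_eqF.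
    + by ring.
  apply: convP => //; apply/andP; split.
    by rewrite /l subr_ge0 ler_pdivrMr // mul1r; lra.
  by rewrite /l gerBl divr_ge0 ?ltW.
(* Only prefixes that contain [j] but not [k] lose [d]. There [v <= m] by minimality of [k], and the
   gap at [j] alone covers the loss. *)
- move=> i; rewrite sum_m' /=.
  case: (ltnP k i) => [lt_ki|le_ik].
    by rewrite (ltn_trans lt_jk lt_ki) subrK.
  rewrite mulr0 addr0; case: ltnP => [lt_ji|_]; last by rewrite mulr0 subr0.
  rewrite mulr1 lerBrDr -lerBrDl -sumrB (bigD1 j) //=.
  rewrite (le_trans d_lej) // lerDl sumr_ge0 // => h /andP[lt_hi _].
  rewrite subr_ge0 leNgt; apply: contraL (leq_trans lt_hi le_ik) => /k_min.
  by rewrite -leqNgt.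
- by rewrite sum_m' /= subrK.
Qed.
End HLP.

(* [w i = u i] for [i < k] and [w i] is the normalized tail sum
   [(u_k + .. + u_(n-1)) / (s - k)] for [i >= k], where [k] is the least index
   such that this value is at least [u k]. *)
Lemma nikolov_weights (R : realFieldType) (n s : nat) (u : nat -> R) :
  (0 < s <= n)%N -> (forall i j, (i <= j)%N -> u j <= u i) ->
  (forall i, 0 <= u i) -> 0 < u s.-1 ->
  exists w : nat -> R,
    [/\ forall i, 0 < w i, forall i j, (i <= j)%N -> w j <= w i,
        \sum_(0 <= i < n) u i / w i = s%:R,
        forall k, (k <= n)%N -> \sum_(0 <= i < k) u i <=
          \sum_(0 <= i < k) (if (i < s)%N then w i else 0) &
        \sum_(0 <= i < n) u i =
          \sum_(0 <= i < n) (if (i < s)%N then w i else 0)].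
Proof.
move=> /andP[s_gt0 le_sn] u_noninc u_ge0 us_gt0.
pose T k := \sum_(k <= i < n) u i.
pose good k := (k < s)%N && (u k * (s - k)%:R <= T k).
have ex_good : exists k, good k.
  (* At [s.-1] the divisor is 1, and the tail contains [u s.-1] itself. *)
  exists s.-1; rewrite /good ltn_predL s_gt0 /=.
  have -> : (s - s.-1 = 1)%N by rewrite -[X in (X - _)%N](prednK s_gt0) subSnn.
  rewrite mulr1 /T big_ltn; last by rewrite prednK.
  by rewrite lerDl sumr_ge0.
case: (ex_minnP ex_good) => k /andP[lt_ks k_good] k_min.
have sk_gt0 : 0 < (s - k)%:R :> R by rewrite ltr0n subn_gt0.
have uk_gt0 i : (i <= k)%N -> 0 < u i.
  move=> le_ik; apply: (lt_le_trans us_gt0); apply: u_noninc.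
  by rewrite (leq_trans le_ik) // -ltnS prednK.
pose c := T k / (s - k)%:R.
have le_ukc : u k <= c by rewrite ler_pdivlMr.
have c_gt0 : 0 < c by rewrite (lt_le_trans _ le_ukc) // uk_gt0.
(* For positive [k], failure of [good] at the predecessor, after removing one copy of its [u] from
   both sides, says that [c] is below that value of [u]. *)
have le_cu i : (i < k)%N -> c <= u i.
  case: k lt_ks k_good k_min @c sk_gt0 le_ukc c_gt0 uk_gt0 => //
    k lt_ks _ k_min c sk_gt0 _ _ _.
  rewrite ltnS => /u_noninc; apply: le_trans.
  rewrite ler_pdivrMr //.
  have : ~~ good k by apply/negP => /k_min; rewrite ltnn.
  rewrite /good (ltnW lt_ks) /= -ltNge /T big_ltn; last first.
    by rewrite (leq_trans _ le_sn) // ltnW.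
  rewrite subnS -[in X in _ < X](@prednK (s - k)) ?subn_gt0 1?ltnW //.
  by rewrite -natr1 mulrDr mulr1 addrC ltrD2r => /ltW.
have le_kn : (k <= n)%N by rewrite (leq_trans (ltnW lt_ks)).
pose w i := if (i < k)%N then u i else c.
pose m i := if (i < s)%N then w i else 0.
have sum_low j : (j <= k)%N -> \sum_(0 <= i < j) u i = \sum_(0 <= i < j) m i.
  move=> le_jk; apply: eq_big_nat => i /andP[_ lt_ij].
  have lt_ik := leq_trans lt_ij le_jk.
  by rewrite /m /w lt_ik (ltn_trans lt_ik lt_ks).
have sum_mid j : (k <= j <= s)%N ->
    \sum_(0 <= i < j) m i = \sum_(0 <= i < k) u i + c * (j - k)%:R.
  move=> /andP[le_kj le_js]; rewrite (big_cat_nat (n := k)) //=.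
  rewrite -sum_low //; congr (_ + _).
  rewrite (eq_big_nat _ _ (F2 := fun=> c)); last first.
    move=> i /andP[le_ki lt_ij].
    by rewrite /m /w (leq_trans lt_ij le_js) ltnNge le_ki.
  by rewrite sumr_const_nat mulr_natr.
have sum_top j : (s <= j)%N -> \sum_(0 <= i < j) m i = \sum_(0 <= i < n) u i.
  move=> le_sj; rewrite (big_cat_nat (n := s)) //= (sum_mid s) ?leqnn ?andbT;
    last exact: ltnW.
  rewrite [X in _ + X]big1_seq ?addr0; last first.
    by move=> i; rewrite mem_index_iota => /and3P[_ le_si _]; rewrite /m ltnNge le_si.
  by rewrite [RHS](big_cat_nat (n := k)) //= /c divfK // gt_eqF.
exists w; split.
- by move=> i; rewrite /w; case: ifP => // lt_ik; rewrite uk_gt0 // ltnW.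
- move=> i j le_ij; rewrite /w; case: (ltnP j k) => [lt_jk|le_kj].
    by rewrite (leq_ltn_trans le_ij lt_jk) u_noninc.
  by case: (ltnP i k) => // /le_cu.
(* The first [k] quotients are 1 each; the others add up to [T k / c], which is [s - k]. *)
- rewrite (big_cat_nat (n := k)) //= (eq_big_nat _ _ (F2 := fun=> 1)); last first.
    by move=> i /andP[_ lt_ik]; rewrite /w lt_ik divff // gt_eqF // uk_gt0 // ltnW.
  rewrite sumr_const_nat subn0 [X in _ + X](eq_big_nat _ _ (F2 := fun i => u i / c)).
    rewrite -mulr_suml -/(T k) /c invf_div mulrCA divff ?mulr1; last first.
      by apply: contraTneq c_gt0 => T0; rewrite /c T0 mul0r ltxx.
    by rewrite -natrD subnKC // ltnW.
  by move=> i /andP[le_ki _]; rewrite /w ltnNge le_ki.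
(* Up to [k] the prefixes coincide; from [k] to [s] one has [u i <= u k <= c]; beyond [s] the right
   side is already the full total of the nonnegative [u]. *)
- move=> j le_jn; rewrite -[leRHS]/(\sum_(0 <= i < j) m i).
  case: (leqP j k) => [/sum_low ->|lt_kj] //.
  case: (leqP j s) => [le_js|lt_sj].
    rewrite sum_mid ?(ltnW lt_kj) // (big_cat_nat (n := k)) ?(ltnW lt_kj) //=.
    rewrite lerD2l mulr_natr -sumr_const_nat !big_nat; apply: ler_sum => i /andP[le_ki _].
    by rewrite (le_trans (u_noninc _ _ le_ki)).
  rewrite (sum_top j (ltnW lt_sj)) [leRHS](big_cat_nat (n := j)) //= lerDl.
  exact: sumr_ge0.
- by rewrite -(sum_top n).
Qed.

Lemma sum_indicator (R : pzSemiRingType) (n s : nat) : (s <= n)%N ->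
  \sum_(i < n) (i < s)%N%:R = s%:R :> R.
Proof.
move=> le_sn; rewrite (eq_bigr (fun i : 'I_n => if (i < s)%N then 1 else 0)).
  by rewrite -big_mkcond -(big_ord_widen n (fun=> 1)) // sumr_const card_ord.
by move=> i _; case: ifP.
Qed.

(** * Spectral inequalities and bounds on the concave envelope *)

Section Envelope.
Context {R : realType} {n : nat}.
Implicit Types (A B N V W Y : 'M[R]_n) (x : 'I_n -> R) (w : nat -> R).

(** Squared entries of an orthogonal matrix form a doubly stochastic matrix, so sums over its first
    [k] rows are admissible weights for [bathtub]. *)
Lemma orth_weights W (k : nat) : W *m W^T = 1%:M ->
  let q := fun i => \sum_(j < n | (j < k)%N) W j i ^+ 2 in
  (forall i, 0 <= q i <= 1) /\
  \sum_(i < n) q i = \sum_(i < n | (i < k)%N) 1.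
Proof.
move=> WW q; split=> [i|].
  rewrite /q sumr_ge0 => [|j _]; last exact: sqr_ge0.
  have <- : \sum_(j < n) W j i ^+ 2 = 1.
    have /matrixP/(_ i i) := mulmx1C WW; rewrite !mxE eqxx; apply: etrans.
    by apply: eq_bigr => j _; rewrite mxE expr2.
  rewrite big_mkcond ler_sum // => j _.
  by case: ifP => // _; rewrite sqr_ge0.
rewrite /q exchange_big /=; apply: eq_bigr => j _.
have /matrixP/(_ j j) := WW; rewrite !mxE eqxx; apply: etrans.
by apply: eq_bigr => i _; rewrite mxE expr2.
Qed.

(** In an eigenbasis of [N], each eigenvalue splits into quadratic forms of [B] and of the diagonal
    part. [bathtub] bounds the former. *)
Lemma eig_sum_shift_le B N x (s : nat) (t : R) (k : nat) :
  psd B -> 0 <= t -> (s <= n)%N -> feasible s x ->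
  N = B + t *: diag_mx (\row_i x i) ->
  \sum_(i < n | (i < k)%N) eig N i <=
  \sum_(i < n | (i < k)%N) (eig B i + t * (i < s)%N%:R).
Proof.
move=> psdB t_ge0 le_sn [x01 sx] NE; have [symB _] := psdB.
have symN : N^T = N by rewrite NE linearD /= linearZ /= tr_diag_mx symB.
have [U [UU NU]] := spectral_eig _ symN; have U'U := mulmx1C UU.
have [V [VV BV]] := spectral_eig _ symB.
pose W := U^T *m V.
have WW : W *m W^T = 1%:M.
  by rewrite /W trmx_mul trmxK mulmxA -[U^T *m V *m _]mulmxA VV mulmx1.
have UTU : U^T *m U^T^T = 1%:M by rewrite trmxK.
have eigN (j : 'I_n) : eig N j = \sum_(i < n) eig B i * W j i ^+ 2 +
    t * \sum_(i < n) x i * U^T j i ^+ 2.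
  have -> : eig N j = (U^T *m N *m U) j j.
    by rewrite {2}NU !mulmxA U'U mul1mx -mulmxA U'U mulmx1 !mxE eqxx.
  rewrite NE mulmxDr mulmxDl -scalemxAr -scalemxAl mxE [X in _ + X]mxE.
  congr (_ + _ * _).
    have -> : U^T *m B *m U = W *m diag_mx (\row_i eig B i) *m W^T.
      by rewrite {1}BV /W trmx_mul trmxK !mulmxA.
    by rewrite conj_diagE; apply: eq_bigr => i _; rewrite mxE expr2.
  have -> : U^T *m diag_mx (\row_i x i) *m U =
    U^T *m diag_mx (\row_i x i) *m U^T^T by rewrite trmxK.
  by rewrite conj_diagE; apply: eq_bigr => i _; rewrite mxE expr2.
under eq_bigr => j _ do rewrite eigN.
rewrite !big_split /= -!mulr_sumr; apply: lerD.
  rewrite exchange_big /=; under eq_bigr => i _ do rewrite -mulr_sumr.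
  have [q01 sq] := orth_weights W k WW.
  by apply: bathtub => // i j; exact: psd_eig_nonincr.
apply: ler_wpM2l => //; rewrite exchange_big /=.
under eq_bigr => i _ do rewrite -mulr_sumr.
have [q01 sq] := orth_weights _ k UTU.
(* The diagonal part is at most [k] because [x i <= 1], and at most [s] because the weights are at
   most 1 and [x] sums to [s]. *)
have [le_ks|lt_sk] := leqP k s.
  rewrite [leRHS](eq_bigr (fun=> 1)); last by move=> j lt_jk; rewrite (leq_trans lt_jk).
  rewrite -sq; apply: ler_sum => i _.
  have /andP[q0 _] := q01 i; have /andP[_ x1] := x01 i.
  by rewrite ler_piMl.
have -> : \sum_(i < n | (i < k)%N) (i < s)%N%:R = s%:R :> R.
  rewrite -(sum_indicator _ _ _ le_sn) big_mkcond; apply: eq_bigr => i _.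
  by case: ifP => // /negbT; rewrite -leqNgt => /(leq_trans (ltnW lt_sk)); case: ltnP.
rewrite -sx; apply: ler_sum => i _.
have /andP[_ q1] := q01 i; have /andP[x0 _] := x01 i.
by rewrite ler_piMr.
Qed.

(** The trace is smallest when the largest eigenvalues meet the smallest reciprocals. Expanded in an
    eigenbasis of [Y], the difference is an Abel sum. *)
Lemma trace_weighted_ge V Y w : V *m V^T = 1%:M -> psd Y ->
  (forall i, 0 < w i) -> (forall i j, (i <= j)%N -> w j <= w i) ->
  \sum_(i < n) eig Y i / w i <=
    \tr (V *m diag_mx (\row_i (w i)^-1) *m V^T *m Y).
Proof.
move=> VV psdY w_gt0 w_noninc; have [symY _] := psdY.
have [U [UU YU]] := spectral_eig _ symY.
pose W := U^T *m V.
have WW : W *m W^T = 1%:M.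
  rewrite /W trmx_mul trmxK mulmxA -[U^T *m V *m _]mulmxA VV mulmx1.
  exact: mulmx1C.
have -> : \tr (V *m diag_mx (\row_i (w i)^-1) *m V^T *m Y) =
    \sum_(j < n) eig Y j * \sum_(i < n) (w i)^-1 * W j i ^+ 2.
  rewrite {1}YU !mulmxA mxtrace_mulC !mulmxA.
  have -> : U^T *m V *m diag_mx (\row_i (w i)^-1) *m V^T *m U =
      W *m diag_mx (\row_i (w i)^-1) *m W^T.
    by rewrite /W trmx_mul trmxK !mulmxA.
  rewrite /mxtrace; apply: eq_bigr => j _.
  rewrite mul_mx_diag mxE conj_diagE mulrC mxE; congr (_ * _).
  by apply: eq_bigr => i _; rewrite mxE expr2.
rewrite -subr_ge0 -sumrB.
under eq_bigr => j _ do rewrite -mulrBr.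
apply: abel_sum_ge0 => [i j||k].
- exact: psd_eig_nonincr.
- exact: eig_default.
rewrite sumrB subr_ge0 exchange_big /=.
under [leRHS]eq_bigr => i _ do rewrite -mulr_sumr.
have [q01 sq] := orth_weights W k WW.
(* The reciprocals increase, so [bathtub] is applied to their negatives. *)
have := @bathtub R n (fun i => - (w i)^-1) _ k _ q01 sq.
rewrite /=; under eq_bigr => i _ do rewrite mulNr.
rewrite !sumrN lerN2; apply => i j le_ij.
by rewrite lerN2 lef_pV2 ?posrE ?w_noninc.
Qed.

Lemma Phi_hat_le B (s : nat) (t : R) w : psd B -> 0 < t -> (s <= n)%N ->
  (forall i, 0 < w i) -> (forall i j, (i <= j)%N -> w j <= w i) ->
  \sum_(i < n) (eig B i + t * (i < s)%N%:R) / w i = s%:R ->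
  (Phi_hat s B t <= (\sum_(i < s) ln (w i))%:E)%E.
Proof.
move=> psdB t_gt0 le_sn w_gt0 w_noninc sum_s; have [symB _] := psdB.
have [V [VV BV]] := spectral_eig _ symB; have V'V := mulmx1C VV.
pose L := V *m diag_mx (\row_i (w i)^-1) *m V^T.
(* Constant terms of the tangents [ln y <= ln (w i) + y / w i - 1] taken at [y = eig Y i + t]. The
   hypothesis on the weighted sum cancels the [s] ones when [g] is evaluated at [B]. *)
pose cst := \sum_(i < s) (ln (w i) + t / w i - 1).
pose g Y := \tr (L *m Y) + cst.
have gB : g B = \sum_(i < s) ln (w i).
  have trLB : \tr (L *m B) = \sum_(i < n) eig B i / w i.
    rewrite {1}BV /L !mulmxA mxtrace_mulC !mulmxA V'V mul1mx.
    rewrite -[_ *m V^T *m V]mulmxA V'V mulmx1 mul_diag_mx.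
    by apply: eq_bigr => i _; rewrite !mxE eqxx mulrC.
  have sumt : \sum_(i < n) t * (i < s)%N%:R / w i = \sum_(i < s) t / w i.
    rewrite (big_ord_widen n (fun i => t / w i)) // big_mkcond /=.
    rewrite [RHS]big_mkcond; apply: eq_bigr => i _.
    by case: ifP => _; rewrite ?mulr1 ?mulr0 ?mul0r.
  move: sum_s; under eq_bigr => i _ do rewrite mulrDl.
  rewrite big_split /= sumt -trLB => trE.
  rewrite /g /cst sumrB big_split /= sumr_const card_ord -trE.
  by ring.
rewrite -gB; apply: ereal_inf_lbound; exists g => //; split=> [X Y l _ _ _|Y psdY].
  have -> : g (l *: X + (1 - l) *: Y) = l * g X + (1 - l) * g Y.
    by rewrite /g mulmxDr -!scalemxAr mxtraceD !mxtraceZ; ring.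
  exact: lexx.
have eigt_gt0 i : 0 < eig Y i + t by rewrite ltr_wpDl // psd_eig_ge0.
rewrite /Phi (eq_bigr (fun i : 'I_s => (ln (eig Y i + t))%:E)); last first.
  by move=> i _; rewrite /logE eigt_gt0.
rewrite sumEFin lee_fin; apply: (@le_trans _ _ (\sum_(i < s) eig Y i / w i + cst)).
  rewrite /cst -big_split; apply: ler_sum => i _ /=.
  have z_gt0 : 0 < (eig Y i + t) / w i by rewrite divr_gt0.
  have : ln ((eig Y i + t) / w i) <= (eig Y i + t) / w i - 1.
    by rewrite -[X in ln X](subrK 1) addrC le_ln1Dx // ltrBrDr addNr.
  by rewrite ln_div ?posrE // mulrDl; lra.
(* The terms with index at least [s] are nonnegative, so the sum may be extended to [n]. *)
rewrite lerD2r; apply: le_trans (trace_weighted_ge V Y w VV psdY w_gt0 w_noninc).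
rewrite (big_ord_widen n (fun i => eig Y i / w i)) // big_mkcond.
apply: ler_sum => i _; case: ifP => // _.
by rewrite divr_ge0 ?psd_eig_ge0 ?ltW.
Qed.

(** In a fixed eigenbasis of [N], a concave majorant [g] restricts to a concave function of the
    diagonal; its lower bound at the permutations of [m] spreads to all that [m] majorizes. *)
Lemma Phi_hat_ge N (s : nat) w : psd N -> (s <= n)%N ->
  (forall i, 0 < w i) -> (forall i j, (i <= j)%N -> w j <= w i) ->
  let m := fun i => if (i < s)%N then w i else 0 in
  (forall k, \sum_(i < n | (i < k)%N) eig N i <= \sum_(i < n | (i < k)%N) m i) ->
  \sum_(i < n) eig N i = \sum_(i < n) m i ->
  ((\sum_(i < s) ln (w i))%:E <= Phi_hat s N 0)%E.
Proof.
move=> psdN le_sn w_gt0 w_noninc m prefix total; have [symN _] := psdN.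
have m_noninc i j : (i <= j)%N -> m j <= m i.
  rewrite /m => le_ij; case: (ltnP j s) => [lt_js|_].
    by rewrite (leq_ltn_trans le_ij lt_js) w_noninc.
  by case: ifP => // _; rewrite ltW.
have m_ge0 i : 0 <= m i by rewrite /m; case: ifP => // _; rewrite ltW.
have [U [UU NU]] := spectral_eig _ symN.
apply: le_ereal_inf_tmp => _ [g [g_concave g_ge] <-]; rewrite lee_fin.
pose D (v : 'I_n -> R) := U *m diag_mx (\row_i v i) *m U^T.
(* Nonnegativity is carried along because [g] is concave only between psd matrices. *)
pose P (v : 'I_n -> R) :=
  (forall i, 0 <= v i) /\ \sum_(i < s) ln (w i) <= g (D v).
suff [_] : P (fun i => eig N i) by rewrite /D -NU.
have psdD v : (forall i, 0 <= v i) -> psd (D v).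
  by move=> v_ge0; apply: psd_conj_diag => i; rewrite mxE.
apply: (@majorization_convex R n P _ (fun i => m i)) => //.
- move=> x y l l01 [x_ge0 gx] [y_ge0 gy]; have /andP[l0 l1] := l01.
  split=> [i|]; first by rewrite addr_ge0 ?mulr_ge0 ?subr_ge0.
  have -> : D (fun i => l * x i + (1 - l) * y i) = l *: D x + (1 - l) *: D y.
    rewrite /D; apply/matrixP => i j; rewrite conj_diagE.
    rewrite [RHS]mxE [X in _ = X + _]mxE [X in _ = _ + X]mxE.
    rewrite !conj_diagE !mulr_sumr -big_split; apply: eq_bigr => k _ /=.
    by rewrite !mxE; ring.
  apply: le_trans (g_concave _ _ _ (psdD _ x_ge0) (psdD _ y_ge0) l01).
  have : l * (\sum_(i < s) ln (w i)) <= l * g (D x) by rewrite ler_wpM2l.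
  have : (1 - l) * (\sum_(i < s) ln (w i)) <= (1 - l) * g (D y).
    by rewrite ler_wpM2l ?subr_ge0.
  lra.
(* The zeros of [m] start at index [s], so only positive eigenvalues enter [Phi] and no logarithm is
   infinite. *)
- move=> p; split=> [i|]; first exact: m_ge0.
  rewrite -lee_fin; apply: le_trans (g_ge _ (psdD _ _)); last first.
    by move=> i; exact: m_ge0.
  rewrite /Phi -sumEFin; apply: lee_sum => i _.
  have lt_in : (i < n)%N by rewrite (leq_trans _ le_sn).
  rewrite addr0 /D (eig_conj_diag_perm U m p UU m_noninc) //.
  by rewrite /m ltn_ord /logE w_gt0.
- by move=> i j; exact: psd_eig_nonincr.
Qed.

Lemma MxE A x : Mx A x = A *m diag_mx (\row_i x i) *m A^T.
Proof.
apply/matrixP => i j; rewrite conj_diagE summxE; apply: eq_bigr => k _.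
by rewrite !mxE big_ord1 !mxE.
Qed.

(** Commuting the factors of the characteristic polynomial replaces the Cholesky factor by
    [A^T *m A], which depends affinely on [t] in the application. *)
Lemma eig_Mx A x i : (forall j, 0 <= x j) ->
  eig (Mx A x) i =
    eig (diag_mx (\row_j Num.sqrt (x j)) *m (A^T *m A) *m
         diag_mx (\row_j Num.sqrt (x j))) i.
Proof.
move=> x_ge0; rewrite /eig; congr nth; apply: eq_eigs.
rewrite MxE; set E := diag_mx _; set S := diag_mx _.
have -> : E = S *m S.
  rewrite /S mulmx_diag; congr diag_mx; apply/rowP => j.
  by rewrite !mxE -expr2 sqr_sqrtr.
by rewrite mulmxA -mulmxA char_poly_mulC !mulmxA.
Qed.

Lemma psd_Mx A x : (forall j, 0 <= x j) -> psd (Mx A x).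
Proof. by move=> x_ge0; rewrite MxE; apply: psd_conj_diag => i; rewrite mxE. Qed.

Lemma psd_sandwich A W : W^T = W -> psd (W *m (A^T *m A) *m W).
Proof.
move=> symW; have -> : W *m (A^T *m A) *m W =
  (A *m W)^T *m diag_mx (\row_i 1) *m (A *m W)^T^T.
  have -> : diag_mx (\row_i (1 : R)) = 1%:M :> 'M_n.
    by apply/matrixP => i j; rewrite !mxE.
  by rewrite trmxK trmx_mul symW mulmx1 !mulmxA.
by apply: psd_conj_diag => i; rewrite mxE.
Qed.
End Envelope.

Theorem theorem2 (R : realType) (n s : nat) (C : 'M[R]_n) (A : R -> 'M[R]_n) :
  (1 <= n)%N -> (1 <= s <= n)%N -> posdef C ->
  (forall t : R, 0 <= t <= lambda_min C -> cholesky_factor (C - t%:M) (A t)) ->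
  forall t : R, 0 < t <= lambda_min C ->
    (z_hat s A t <= z_hat s A 0)%E.
Proof.
move=> _ s_range _ chol t /andP[t_gt0 le_t]; have /andP[s_gt0 le_sn] := s_range.
have [AtE _ _] : cholesky_factor (C - t%:M) (A t) by apply: chol; rewrite ltW.
have [] : cholesky_factor (C - 0%:M) (A 0).
  by apply: chol; rewrite lexx ltW // (lt_le_trans t_gt0).
rewrite raddf0 subr0 => A0E _ _.
(* The suprema are compared pointwise: the same [x] serves on both sides. *)
apply: ge_ereal_sup => _ [x x_feas <-]; apply: le_ereal_sup_tmp.
exists (Phi_hat s (Mx (A 0) x) 0); first by exists x.
have [x01 sx] := x_feas.
have x_ge0 i : 0 <= x i by have /andP[] := x01 i.
pose S := diag_mx (\row_j Num.sqrt (x j)).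
pose B := S *m ((A t)^T *m A t) *m S; pose N := S *m ((A 0)^T *m A 0) *m S.
have symS : S^T = S by rewrite tr_diag_mx.
have psdB : psd B by exact: psd_sandwich.
have eigB i : eig (Mx (A t) x) i = eig B i by exact: eig_Mx.
have eigN i : eig (Mx (A 0) x) i = eig N i by exact: eig_Mx.
have NE : N = B + t *: diag_mx (\row_i x i).
  rewrite /N /B -AtE -A0E mulmxBr mulmxBl mul_mx_scalar -scalemxAl.
  have -> : S *m S = diag_mx (\row_i x i).
    rewrite mulmx_diag; congr diag_mx; apply/rowP => j.
    by rewrite !mxE -expr2 sqr_sqrtr.
  by rewrite subrK.
have symN : N^T = N by rewrite NE linearD /= linearZ /= tr_diag_mx psdB.1.
pose u i := eig B i + t * (i < s)%N%:R.
have u_ge0 i : 0 <= u i by rewrite addr_ge0 ?psd_eig_ge0 // mulr_ge0 // ltW.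
have u_noninc i j : (i <= j)%N -> u j <= u i.
  move=> le_ij; apply: lerD; first exact: psd_eig_nonincr.
  apply: ler_wpM2l; rewrite ?(ltW t_gt0) // ler_nat.
  by case: (ltnP j s) => // lt_js; rewrite (leq_ltn_trans le_ij lt_js).
(* The shift reaches index [s.-1], so positivity holds even where the eigenvalue of [B] vanishes. *)
have us_gt0 : 0 < u s.-1.
  by rewrite ltr_wpDl ?psd_eig_ge0 // ltn_predL s_gt0 mulr1.
have [w [w_gt0 w_noninc sum_uw prefix total]] :=
  nikolov_weights _ _ _ _ s_range u_noninc u_ge0 us_gt0.
apply: (@le_trans _ _ (\sum_(i < s) ln (w i))%:E).
  apply: Phi_hat_le => //; first exact: psd_Mx.
  by rewrite -sum_uw big_mkord; apply: eq_bigr => i _; rewrite eigB.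
have eig_le k : \sum_(i < n | (i < k)%N) eig (Mx (A 0) x) i <=
    \sum_(i < n | (i < k)%N) u i.
  under eq_bigr => i _ do rewrite eigN.
  by apply: eig_sum_shift_le => //; rewrite ltW.
have sumE (F : nat -> R) k :
    \sum_(i < n | (i < k)%N) F i = \sum_(0 <= i < minn k n) F i.
  rewrite big_mkord (big_ord_widen n F) ?geq_minr //.
  by apply: eq_bigl => i; rewrite leq_min ltn_ord andbT.
apply: Phi_hat_ge => // [|k|]; first exact: psd_Mx.
  apply: (le_trans (eig_le k)); rewrite sumE.
  rewrite (sumE (fun i => if (i < s)%N then w i else 0)).
  by apply: prefix; rewrite geq_minr.
(* Equality of totals is a trace identity: the diagonal part contributes [t] times the sum of [x],
   which is [s]. *)
move: total; rewrite !big_mkord => <-.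
under [LHS]eq_bigr => i _ do rewrite eigN.
rewrite sum_eig // NE mxtraceD mxtraceZ.
rewrite big_split /= -mulr_sumr sum_eig ?psdB.1 // sum_indicator // -sx.
by rewrite mxtrace_diag; congr (_ + _ * _); apply: eq_bigr => i _; rewrite mxE.
Qed.
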